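(* Let $E(m,n)$ denote the expected number of rounds in Urn Solitaire started with $m$ green and $n$ red balls (equivalently, the function determined by the recurrence given in the context). Then for all integers $m\ge 1$ and $n\ge 1$, $$ 2(m+2)(m+1)(2mn+2m+7n+9)(m+3)\,E(m,n) $$ $$ -(m+3)(m+2)\bigl(14m^2n+6mn^2+14m^2+83mn+21n^2+91m+123n+128\bigr)\,E(m+1,n) $$ $$ +(m+3)\bigl(18m^3n+16m^2n^2+2mn^3+18m^3+167m^2n+94mn^2+7n^3+169m^2+521mn+132n^2+511m+537n+508\bigr)\,E(m+2,n) $$ $$ +\bigl(-10m^4n-14m^3n^2-4m^2n^3-10m^4-135m^3n-129m^2n^2-24mn^3-131m^3-684m^2n-393mn^2-34n^3-639m^2-1535mn-396n^2-1380m-1286n-1116\bigr)\,E(m+3,n) $$ $$ +(m+3)(2mn+2m+5n+7)(m+n+4)(m+n+3)\,E(m+4,n)=0 . $$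
   Context: Urn Solitaire: an urn contains $m$ green and $n$ red balls. A round consists of drawing balls uniformly at random without replacement, noting the color of the first ball, and continuing to draw until a ball of the other color is drawn; that last ball is returned to the urn. Rounds are repeated, and the game is considered over as soon as the urn contains balls of only one color (or is empty). $E(m,n)$ is the expected number of rounds until the game is over. Equivalently, $E(m,0)=E(0,n)=0$ for all $m,n\ge 0$, and for $m,n\ge 1$, $$E(m,n)=1+\sum_{k=1}^{m}\frac{\binom{m}{k}}{\binom{m+n}{k}}\cdot\frac{n}{m+n-k}\,E(m-k,n)+\sum_{k=1}^{n}\frac{\binom{n}{k}}{\binom{m+n}{k}}\cdot\frac{m}{m+n-k}\,E(m,n-k).$$ *)

(* Defs.v *)
From mathcomp Require Import all_boot all_order all_algebra.
From mathcomp Require Import zify ring.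

Set Implicit Arguments.
Unset Strict Implicit.
Unset Printing Implicit Defensive.

Import Order.TTheory GRing.Theory Num.Theory.
Local Open Scope ring_scope.

(* A finitely supported distribution is a list of weighted outcomes; the same
   outcome may occur several times, its weights being added up. *)
Definition dist (T : Type) := seq (rat * T).

Definition dret (T : Type) (x : T) : dist T := [:: (1, x)].

Definition dbind (T U : Type) (d : dist T) (f : T -> dist U) : dist U :=
  flatten [seq [seq (p.1 * q.1, q.2) | q <- f p.2] | p <- d].

Definition dmap (T U : Type) (f : T -> U) (d : dist T) : dist U :=
  [seq (p.1, f p.2) | p <- d].

Definition expect (T : Type) (d : dist T) (f : T -> rat) : rat :=
  \sum_(p <- d) p.1 * f p.2.

(* One ball drawn uniformly at random among a balls of one color and b balls of
   the other: [true] if it is one of the a balls. *)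
Definition draw (a b : nat) : dist bool :=
  [:: (a%:R / (a + b)%:R, true); (b%:R / (a + b)%:R, false)].

(* The remainder of a round after its first ball: a balls of the color of that
   ball and b of the other color are in the urn, and balls are drawn until one
   of the other color appears, which is put back.  The outcome is the number of
   balls left of the first color.  When a = 0 < b the next ball is surely of
   the other color. *)
Fixpoint finish_round (a b : nat) : dist nat :=
  if a is a'.+1 then
    dbind (draw a b) (fun same => if same then finish_round a' b else dret a)
  else dret 0%N.

(* (number of green balls, number of red balls) *)
Definition urn := (nat * nat)%type.

(* Only used when both colors are present. *)
Definition round (u : urn) : dist urn :=
  let: (m, n) := u in
  dbind (draw m n) (fun green =>
    if green then dmap (fun g => (g, n)) (finish_round m.-1 n)
    else dmap (fun r => (m, r)) (finish_round n.-1 m)).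

Definition over (u : urn) : bool := (u.1 == 0%N) || (u.2 == 0%N).

(* A state is an urn together with the number of rounds played so far. *)
Definition step (s : urn * nat) : dist (urn * nat) :=
  if over s.1 then dret s else dmap (fun v => (v, s.2.+1)) (round s.1).

Definition play (t : nat) (s : urn * nat) : dist (urn * nat) :=
  iter t (fun d => dbind d step) (dret s).

(* A round removes at least one ball, so the game is over after at most m + n
   rounds (see [play_over]), and the counter stops increasing from then on. *)
Definition E (m n : nat) : rat :=
  expect (play (m + n) ((m, n), 0%N)) (fun s => s.2%:R).

Lemma expect_ret T (x : T) f : expect (dret x) f = f x.
Proof. by rewrite /expect big_seq1 mul1r. Qed.

Lemma expect_bind T U (d : dist T) (g : T -> dist U) f :
  expect (dbind d g) f = expect d (fun x => expect (g x) f).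
Proof.
rewrite /expect /dbind big_flatten big_map; apply: eq_bigr => p _.
by rewrite big_map mulr_sumr; apply: eq_bigr => q _; rewrite mulrA.
Qed.

Lemma expect_map T U (d : dist T) (g : T -> U) f :
  expect (dmap g d) f = expect d (f \o g).
Proof. by rewrite /expect big_map. Qed.

Lemma eq_expect T (d : dist T) f g : f =1 g -> expect d f = expect d g.
Proof. by move=> fg; apply: eq_bigr => p _; rewrite fg. Qed.

Lemma expectD T (d : dist T) f g :
  expect d (fun x => f x + g x) = expect d f + expect d g.
Proof. by rewrite /expect -big_split; apply: eq_bigr => p _; rewrite mulrDr. Qed.

Lemma expectZ T (d : dist T) c f :
  expect d (fun x => c * f x) = c * expect d f.
Proof. by rewrite /expect mulr_sumr; apply: eq_bigr => p _; rewrite mulrCA. Qed.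

Lemma expect_draw a b f :
  expect (draw a b) f =
  a%:R / (a + b)%:R * f true + b%:R / (a + b)%:R * f false.
Proof. by rewrite /expect big_cons big_seq1. Qed.

Lemma bin_ratioS a b k :
  'C(a.+1, k.+1)%:R / 'C(a.+1 + b, k.+1)%:R
  = a.+1%:R / (a.+1 + b)%:R * ('C(a, k)%:R / 'C(a + b, k)%:R) :> rat.
Proof.
have k0 : k.+1%:R != 0 :> rat by rewrite pnatr_eq0.
have ab0 : (a + b).+1%:R != 0 :> rat by rewrite pnatr_eq0.
have H c : 'C(c.+1, k.+1)%:R = c.+1%:R * 'C(c, k)%:R / k.+1%:R :> rat.
  by rewrite -natrM mul_bin_diag natrM mulrC mulKf.
rewrite addSn !H.
case: (eqVneq ('C(a + b, k)%:R : rat) 0) => [->|c0].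
  by rewrite !(mulr0, mul0r, invr0).
move: ('C(a + b, k)%:R) c0 (_.+1%:R) k0 ((a + b).+1%:R) ab0 => c c0 d d0 e e0.
by field; rewrite c0 d0 e0.
Qed.

Lemma expect_finish a b (f : nat -> rat) : (0 < b)%N ->
  expect (finish_round a b) f =
  \sum_(k < a.+1) 'C(a, k)%:R / 'C(a + b, k)%:R
                  * (b%:R / (a + b - k)%:R) * f (a - k)%N.
Proof.
move=> b0; have bN0 : b%:R != 0 :> rat by rewrite pnatr_eq0 -lt0n.
elim: a => [|a IH].
  by rewrite expect_ret big_ord1 !bin0 subn0 add0n !divff ?mul1r ?oner_eq0.
rewrite [finish_round _ _]/= expect_bind expect_draw expect_ret IH [RHS]big_ord_recl.
rewrite !bin0 !subn0 divr1 mul1r addrC; congr (_ + _).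
rewrite mulr_sumr; apply: eq_bigr => k _.
by rewrite lift0 bin_ratioS addSn !subSS !mulrA.
Qed.

(* A round started with m green and n red balls removes k >= 1 green balls with
   probability 'C(m, k) / 'C(m + n, k) * n / (m + n - k), and likewise for red. *)
Lemma expect_round m n (f : urn -> rat) : (0 < m)%N -> (0 < n)%N ->
  expect (round (m, n)) f =
    (\sum_(1 <= k < m.+1) 'C(m, k)%:R / 'C(m + n, k)%:R
                          * (n%:R / (m + n - k)%:R) * f ((m - k)%N, n))
  + (\sum_(1 <= k < n.+1) 'C(n, k)%:R / 'C(m + n, k)%:R
                          * (m%:R / (m + n - k)%:R) * f (m, (n - k)%N)).
Proof.
case: m => // m; case: n => // n _ _.
rewrite expect_bind expect_draw !expect_map !expect_finish //=.
rewrite !big_add1 !big_mkord; congr (_ + _); rewrite mulr_sumr;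
  apply: eq_bigr => k _ /=.
  by rewrite bin_ratioS addSn !subSS !mulrA.
by rewrite (addnC m.+1) bin_ratioS addSn !subSS !mulrA.
Qed.

Lemma playS t s f :
  expect (play t.+1 s) f = expect (step s) (fun s' => expect (play t s') f).
Proof.
elim: t f => [|t IH] f.
  rewrite /= expect_bind expect_ret; apply: eq_expect => s'.
  by rewrite expect_ret.
rewrite [play t.+2 s]iterS expect_bind IH.
by apply: eq_expect => s'; rewrite [play t.+1 s']iterS expect_bind.
Qed.

Lemma draw_mass a b c : (0 < a + b)%N -> expect (draw a b) (fun=> c) = c.
Proof.
move=> ab; rewrite expect_draw -mulrDl -mulrDl -natrD divff ?mul1r //.
by rewrite pnatr_eq0 -lt0n.
Qed.

Lemma finish_mass a b c : expect (finish_round a b) (fun=> c) = c.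
Proof.
elim: a => [|a IH]; first by rewrite expect_ret.
rewrite [finish_round _ _]/= expect_bind -[RHS](@draw_mass a.+1 b c) //.
by apply: eq_expect => -[]; rewrite ?IH ?expect_ret.
Qed.

Lemma step_mass s c : expect (step s) (fun=> c) = c.
Proof.
rewrite /step; case: s => [[m n] t] /=; case: ifP => [_|]; first exact: expect_ret.
rewrite /over /= => /norP[m0 n0]; rewrite expect_map expect_bind.
rewrite -[RHS](@draw_mass m n c) ?addn_gt0 ?lt0n ?m0 //.
by apply: eq_expect => -[]; rewrite expect_map finish_mass.
Qed.

Lemma play_mass t s c : expect (play t s) (fun=> c) = c.
Proof.
elim: t => [|t IH] in s *; first exact: expect_ret.
by rewrite playS -[RHS](step_mass s); apply: eq_expect => s'; rewrite IH.
Qed.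

Lemma expect_over t u c f : over u -> expect (play t (u, c)) f = f (u, c).
Proof.
by move=> ou; elim: t => [|t IH]; rewrite ?playS /step ?ou expect_ret.
Qed.

Lemma playS_live t u c f : ~~ over u ->
  expect (play t.+1 (u, c)) f =
  expect (round u) (fun v => expect (play t (v, c.+1)) f).
Proof. by move=> /negbTE ou; rewrite playS /step /= ou expect_map. Qed.

(* Only urns with fewer balls are reached. *)
Lemma eq_expect_round u f g : ~~ over u ->
  (forall v, (v.1 + v.2 < u.1 + u.2)%N -> f v = g v) ->
  expect (round u) f = expect (round u) g.
Proof.
case: u => m n; rewrite negb_or /= -!lt0n => /andP[m0 n0] fg.
rewrite !expect_round //; congr (_ + _); apply: eq_big_nat => k /andP[k1 km];
  by rewrite fg //=; lia.
Qed.

Lemma play_over t u c : (u.1 + u.2 <= t)%N ->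
  expect (play t (u, c)) (fun s => (over s.1)%:R) = 1.
Proof.
elim: t => [|t IH] in u c *.
  rewrite leqn0 addn_eq0 => /andP[u0 _]; by rewrite expect_ret /over /= u0.
move=> ut; case: (boolP (over u)) => ou; first by rewrite expect_over /= ?ou.
rewrite playS_live // (@eq_expect_round _ _ (fun=> 1)) //; last first.
  by move=> v vu; apply: IH; lia.
have := step_mass (u, c) 1; by rewrite /step /= (negbTE ou) expect_map.
Qed.

Lemma play_shift t u c :
  expect (play t (u, c)) (fun s => s.2%:R) =
  c%:R + expect (play t (u, 0%N)) (fun s => s.2%:R).
Proof.
elim: t => [|t IH] in u c *; first by rewrite !expect_ret addr0.
case: (boolP (over u)) => ou; first by rewrite !expect_over //= addr0.
have mass x : expect (round u) (fun=> x) = x.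
  by have := step_mass (u, c) x; rewrite /step /= (negbTE ou) expect_map.
rewrite !playS_live // (eq_expect _ (fun v => IH v c.+1)) expectD mass.
rewrite (eq_expect _ (fun v => IH v 1%N)) expectD mass addrA.
by rewrite -natrD addn1.
Qed.

Lemma play_stable t u : (u.1 + u.2 <= t)%N ->
  expect (play t (u, 0%N)) (fun s => s.2%:R) = E u.1 u.2.
Proof.
rewrite /E -surjective_pairing; move: {2 4}(_ + _)%N (leqnn (u.1 + u.2)) => t'.
elim: t => [|t IH] in u t' *.
  move=> _; rewrite leqn0 addn_eq0 => /andP[u0 _].
  by rewrite !expect_over // /over u0.
move=> ut' ut; case: (boolP (over u)) => ou; first by rewrite !expect_over.
case: t' => [|t'] in ut' *.
  by move: ou ut'; rewrite /over; lia.
rewrite !playS_live //; apply: eq_expect_round => // v vu.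
by rewrite play_shift [RHS]play_shift (IH v t') //; lia.
Qed.

Lemma E0n n : E 0 n = 0.
Proof. by rewrite /E expect_over. Qed.

Lemma Em0 m : E m 0 = 0.
Proof. by rewrite /E expect_over // /over orbT. Qed.

Lemma E_rec m n : (0 < m)%N -> (0 < n)%N ->
  E m n = 1
  + (\sum_(1 <= k < m.+1) 'C(m, k)%:R / 'C(m + n, k)%:R
                          * (n%:R / (m + n - k)%:R) * E (m - k) n)
  + (\sum_(1 <= k < n.+1) 'C(n, k)%:R / 'C(m + n, k)%:R
                          * (m%:R / (m + n - k)%:R) * E m (n - k)).
Proof.
move=> m0 n0; have ou : ~~ over (m, n) by rewrite /over /=; lia.
rewrite -addrA -(expect_round (fun v => E v.1 v.2)) // {1}/E.
have -> : (m + n = (m + n).-1.+1)%N by lia.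
have mass : expect (round (m, n)) (fun=> 1) = 1.
  by have := step_mass ((m, n), 0%N) 1; rewrite /step (negbTE ou) expect_map.
rewrite playS_live // -{2}mass -expectD; apply: eq_expect_round => //= v vu.
by rewrite play_shift play_stable //; lia.
Qed.

(* Main.v *)
Require Import Defs.
From mathcomp Require Import all_boot all_order all_algebra.
From mathcomp Require Import zify ring lra.

Import Order.TTheory GRing.Theory Num.Theory.
Local Open Scope ring_scope.

(** Let [e(m,n) = 'C(m+n,m) * E m n].  The rules of the game turn into a
    first-order linear partial differential equation for the generating function
    of [e(m,n) / (m+n)]; in the variables [u = x(1-x)] and [v = y(1-y)] its
    differential operator is, up to a factor, the Euler operator
    [u d/du + v d/dv].  Integrating it gives
    [e(m,n) = 1 + (m+n) p(m,n) - 'C(m+n,m) / 2], where [p(m+1,n+1)] is the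
    coefficient of [x^m y^n] in [log((1-x)/(1-y)) / ((y-x)(1-x-y))], that is,
    the solution of Pascal's recurrence with source [1/(m+n+1)].  A contiguity
    relation makes [p], hence [E], satisfy an inhomogeneous recurrence of order
    two in [m]; the theorem is a combination of three shifts of it in which the
    inhomogeneous terms cancel. *)

(** The inner fixpoint lets the recursion descend in either argument; both axes carry the value
    0. *)
Fixpoint harmonic_pascal (m : nat) : nat -> rat :=
  if m is m'.+1 then
    fix row n := if n is n'.+1
      then harmonic_pascal m' n + row n' + (m' + n').+1%:R^-1 else 0
  else fun=> 0.

Local Notation p := harmonic_pascal.

Lemma harmonic_pascal0n n : p 0 n = 0. Proof. by []. Qed.

Lemma harmonic_pascaln0 m : p m 0 = 0. Proof. by case: m. Qed.

Lemma harmonic_pascalSS m n :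
  p m.+1 n.+1 = p m n.+1 + p m.+1 n + (m + n).+1%:R^-1.
Proof. by []. Qed.

Lemma harmonic_pascalC m n : p m n = p n m.
Proof.
elim: m n => [|m IHm] n; first by rewrite harmonic_pascaln0.
elim: n => [|n IHn]; first by rewrite harmonic_pascaln0.
by rewrite !harmonic_pascalSS IHm IHn [(n + m)%N]addnC; ring.
Qed.

Lemma natSr_neq0 n : n.+1%:R != 0 :> rat.
Proof. by rewrite pnatr_eq0. Qed.

(* The defect of this relation satisfies Pascal's recurrence without source and
   vanishes on both axes. *)
Lemma harmonic_pascal_contiguous m n :
  n%:R * p m n.+1 + m%:R * p m.+1 n
  = 2 * (m + n)%:R * p m n + 1 - 'C(m + n, m)%:R.
Proof.
elim: m n => [|m IHm] n.
  by rewrite !harmonic_pascal0n bin0; ring.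
elim: n => [|n IHn].
  by rewrite !harmonic_pascaln0 addn0 binn; ring.
have := IHm n.+1; move: IHn.
have -> : (m.+1 + n.+1 = (m + n).+2)%N by lia.
have -> : (m.+1 + n = (m + n).+1)%N by lia.
have -> : (m + n.+1 = (m + n).+1)%N by lia.
rewrite (binS (m + n).+1 m) (natrD _ 'C(_, m.+1)).
move: 'C(_, m.+1)%:R 'C(_, m)%:R => b1 b2.
rewrite [p m.+1 n.+2]harmonic_pascalSS [p m.+2 n.+1]harmonic_pascalSS.
have -> : p m n.+1 = p m.+1 n.+1 - p m.+1 n - (m + n).+1%:R^-1.
  by rewrite harmonic_pascalSS; ring.
have -> : (m + n.+1).+1 = (m + n).+2 by lia.
have -> : (m.+1 + n).+1 = (m + n).+2 by lia.
move: (p m n.+2) (p m.+2 n) (p m.+1 n) (p m.+1 n.+1) => p1 p2 p3 p4 Hn Hm.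
have t0 := natSr_neq0 (m + n).+1.
(* The brackets are the left sides of the induction hypotheses at [(m+1, n)] and [(m, n+1)]; the two
   source terms add up to the last quotient. *)
transitivity ((n%:R * p4 + m.+1%:R * p2) + (n.+1%:R * p1 + m%:R * p4)
              + 2 * p4 + (m + n).+2%:R / (m + n).+2%:R); first by ring.
rewrite Hn Hm divff //; field; rewrite -natrD nat1r; exact: natSr_neq0.
Qed.

(** Pascal's recurrence and the contiguity relations at [(m, n)] and [(m+1, n)] eliminate the values
    at [n+1]. *)
Lemma harmonic_pascal_rec m n :
  p m.+2 n
  = ((2 * (m + n).+1%:R + m%:R - n%:R) * p m.+1 n - 2 * (m + n)%:R * p m n
     - n%:R * 'C(m + n, m)%:R / m.+1%:R - n%:R / (m + n).+1%:R) / m.+1%:R.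
Proof.
have m0 := natSr_neq0 m.
have H0 := harmonic_pascal_contiguous m n.
have := harmonic_pascal_contiguous m.+1 n.
rewrite harmonic_pascalSS addSn binS natrD => H1.
have -> : n%:R * 'C(m + n, m)%:R / m.+1%:R = 'C(m + n, m.+1)%:R :> rat.
  by rewrite -natrM -[n in (n * _)%N](addKn m) -mul_bin_left natrM mulrC mulKf.
apply: (canRL (mulfK m0)).
have -> : p m.+2 n * m.+1%:R
  = 2 * (m + n).+1%:R * p m.+1 n + 1 - ('C(m + n, m.+1)%:R + 'C(m + n, m)%:R)
    - n%:R * (p m n.+1 + p m.+1 n + (m + n).+1%:R^-1).
  by apply: (canRL (addrK _)); rewrite -H1; ring.
(* Solving for the binomial makes the terms in [p m n.+1] cancel. *)
have -> : 'C(m + n, m)%:R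
  = 2 * (m + n)%:R * p m n + 1 - (n%:R * p m n.+1 + m%:R * p m.+1 n) :> rat.
  by rewrite H0; ring.
ring.
Qed.

Lemma binS_ratio m n : 'C(m.+1 + n, m.+1)%:R
  = 'C(m + n, m)%:R * (m + n).+1%:R / m.+1%:R :> rat.
Proof.
by apply: (canRL (mulfK (natSr_neq0 m))); rewrite -!natrM mulnC -mul_bin_diag mulnC.
Qed.

(** Induction on [a], conditioning on the next draw. Here [f] stands for [E] with the other color
    fixed at [b]; its value at 0 is separate because the closed form would give 1/2 there. *)
Lemma expect_finish_closed_form a b (f : nat -> rat) : (0 < b)%N -> f 0%N = 0 ->
  (forall g, (0 < g <= a)%N ->
     f g = (1 + (g + b)%:R * p g b) / 'C(g + b, g)%:R - 2^-1) ->
  'C(a + b, a)%:R * expect (finish_round a b) f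
  = 2^-1 - 'C(a + b, a)%:R / 2 + b%:R * p a b.+1.
Proof.
move=> b0 f0; elim: a => [|a IH] Hf.
  by rewrite expect_ret f0 bin0 harmonic_pascal0n; ring.
have {}IH : 'C(a + b, a)%:R * expect (finish_round a b) f
  = 2^-1 - 'C(a + b, a)%:R / 2 + b%:R * p a b.+1.
  by apply: IH => g /andP[g0 ga]; apply: Hf; rewrite g0 ltnW.
rewrite [finish_round _ _]/= expect_bind expect_draw expect_ret Hf ?leqnn //.
rewrite harmonic_pascalSS.
have : 'C(a.+1 + b, a.+1)%:R * a.+1%:R = 'C(a + b, a)%:R * (a + b).+1%:R :> rat.
  by rewrite binS_ratio mulfVK ?natSr_neq0.
move: IH; rewrite !addSn.
have c0 : 'C((a + b).+1, a.+1)%:R != 0 :> rat.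
  by rewrite pnatr_eq0 -lt0n bin_gt0; lia.
have s0 := natSr_neq0 (a + b); have a0 := natSr_neq0 a.
have : (a + b).+1%:R = a.+1%:R + b%:R :> rat by rewrite -natrD.
move: (a + b).+1%:R a.+1%:R s0 a0 => s a1 s0 a0 sE.
move: (expect _ _) (p a b.+1) (p a.+1 b) 'C(a + b, a)%:R 'C(_, a.+1)%:R c0.
move=> g p1 p2 c d d0 Hc Hd.
transitivity (d * a1 / s * g + b%:R / s * (1 + s * p2 - d / 2)).
  by field; rewrite d0 s0.
have -> : d * a1 / s * g = c * g by rewrite Hd; field.
have -> : d = c * s / a1 by rewrite -Hd; field.
by rewrite Hc sE; field; rewrite a0 -sE s0.
Qed.

(** Strong induction on the number of balls: the first ball splits the round into two tails,
    evaluated by the previous closed form, and the contiguity relation recombines them. *)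
Lemma E_closed_form m n : (0 < m)%N -> (0 < n)%N ->
  E m n = (1 + (m + n)%:R * p m n) / 'C(m + n, m)%:R - 2^-1.
Proof.
have [k] := ubnP (m + n); elim: k => // k IH in m n *.
case: m n => [|m] [|n] // mnk _ _.
have Hm : 'C(m + n.+1, m)%:R * expect (finish_round m n.+1) (E^~ n.+1)
  = 2^-1 - 'C(m + n.+1, m)%:R / 2 + n.+1%:R * p m n.+2.
  apply: expect_finish_closed_form => // [|g /andP[g0 gm]]; first exact: E0n.
  by apply: IH => //; lia.
have Hn : 'C(n + m.+1, n)%:R * expect (finish_round n m.+1) (E m.+1)
  = 2^-1 - 'C(n + m.+1, n)%:R / 2 + m.+1%:R * p n m.+2.
  (* The colors exchange roles here, through the symmetry of [p] and of the binomials. *)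
  apply: expect_finish_closed_form => // [|g /andP[g0 gn]]; first exact: Em0.
  rewrite IH //; last by lia.
  by rewrite harmonic_pascalC addnC -bin_sub ?leq_addl // addnK.
rewrite E_rec // -addrA -(expect_round (fun v => E v.1 v.2)) //.
rewrite expect_bind expect_draw !expect_map /comp [LHS]/=.
have := harmonic_pascal_contiguous m.+1 n.+1.
rewrite harmonic_pascalSS [p m.+2 n.+1]harmonic_pascalSS.
rewrite [p n _]harmonic_pascalC in Hn.
have : 'C(m.+1 + n.+1, m.+1)%:R * m.+1%:R
  = 'C(m + n.+1, m)%:R * (m.+1 + n.+1)%:R :> rat.
  by rewrite binS_ratio mulfVK ?natSr_neq0.
have : 'C(m.+1 + n.+1, m.+1)%:R * n.+1%:R
  = 'C(n + m.+1, n)%:R * (m.+1 + n.+1)%:R :> rat.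
  rewrite -[in LHS]bin_sub ?leq_addr // addKn [(m.+1 + _)%N]addnC.
  by rewrite binS_ratio addSn mulfVK ?natSr_neq0.
have B0 : 'C(m.+1 + n.+1, m.+1)%:R != 0 :> rat.
  by rewrite pnatr_eq0 -lt0n bin_gt0 leq_addr.
have s0 : (m.+1 + n.+1)%:R != 0 :> rat by rewrite pnatr_eq0.
have -> : (m + n.+1).+1%:R = (m.+1 + n.+1)%:R :> rat by [].
have -> : (m.+1 + n).+1%:R = (m.+1 + n.+1)%:R :> rat by rewrite addnS.
move: Hm Hn; move: (expect _ _) (expect _ _) => r g.
have sE : (m.+1 + n.+1)%:R = m.+1%:R + n.+1%:R :> rat by rewrite natrD.
move: 'C(_, m)%:R 'C(_, n)%:R 'C(_, m.+1)%:R B0 => c d B B0.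
move: (m.+1 + n.+1)%:R m.+1%:R n.+1%:R s0 sE => s x y s0 sE.
move: (p m n.+2) (p m.+2 n) (p m.+1 n.+1) => p1 p2 p3 Hm Hn Hd Hc H.
(* Thus [c / B] and [d / B] are the probabilities of a green and of a red first ball. *)
have cE : c = B * x / s by rewrite Hc; field.
have dE : d = B * y / s by rewrite Hd; field.
have cdE : c + d = B by rewrite cE dE sE; field; rewrite -sE.
transitivity ((B + c * g + d * r) / B).
  by rewrite cE dE; field; rewrite B0 s0.
have HH : x * p2 + y * p1 = s * p3 - B.
  have -> : x * p2 + y * p1
    = (y * (p1 + p3 + s^-1) + x * (p3 + p2 + s^-1)) - s * p3 - s / s.
    by rewrite sE; field; rewrite -sE.
  by rewrite H; field.
have -> : B + c * g + d * r = B + 1 - (c + d) / 2 + (x * p2 + y * p1).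
  by rewrite Hm Hn; field.
by rewrite cdE HH; field.
Qed.

(** Under the closed form the values of [p] cancel, leaving an inverse binomial with a rational
    factor plus a rational function. These are two terms to kill, hence three shifts in the
    theorem. *)
Lemma E_second_order m n : (0 < m)%N -> (0 < n)%N ->
  let x : rat := m%:R in
  let y : rat := n%:R in
  (x + y + 1) / (x + 2) * E m.+2 n - (3 * x + y + 2) / (x + 1) * E m.+1 n
    + 2 * E m n
  = (y + 1) / (x + y + 1) / (x + y + 2) / 'C(m + n, m)%:R
    - ((x + y + 1) / (x + 2) + (y - x) / (x + 1)) / 2.
Proof.
move=> m0 n0 x y; rewrite !E_closed_form // harmonic_pascal_rec.
rewrite !binS_ratio !addSn -!natr1 natrD -/x -/y.
have B0 : 'C(m + n, m)%:R != 0 :> rat by rewrite pnatr_eq0 -lt0n bin_gt0 leq_addr.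
have x0 : 0 <= x := ler0n _ _; have y0 : 0 <= y := ler0n _ _.
move: x y 'C(_, _)%:R (p m n) (p m.+1 n) x0 y0 B0 => {m0 n0} x y B q0 q1 x0 y0 B0.
by field; rewrite B0 /=; repeat (apply/andP; split); apply: lt0r_neq0; lra.
Qed.

Theorem theorem1 (m n : nat) (hm : (1 <= m)%N) (hn : (1 <= n)%N) :
  let x : rat := m%:R in
  let y : rat := n%:R in
  2 * (x + 2) * (x + 1) * (2 * x * y + 2 * x + 7 * y + 9) * (x + 3) * E m n
  - (x + 3) * (x + 2)
    * (14 * x ^+ 2 * y + 6 * x * y ^+ 2 + 14 * x ^+ 2 + 83 * x * y
       + 21 * y ^+ 2 + 91 * x + 123 * y + 128) * E (m + 1) n
  + (x + 3)
    * (18 * x ^+ 3 * y + 16 * x ^+ 2 * y ^+ 2 + 2 * x * y ^+ 3 + 18 * x ^+ 3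
       + 167 * x ^+ 2 * y + 94 * x * y ^+ 2 + 7 * y ^+ 3 + 169 * x ^+ 2
       + 521 * x * y + 132 * y ^+ 2 + 511 * x + 537 * y + 508) * E (m + 2) n
  + (- 10 * x ^+ 4 * y - 14 * x ^+ 3 * y ^+ 2 - 4 * x ^+ 2 * y ^+ 3
     - 10 * x ^+ 4 - 135 * x ^+ 3 * y - 129 * x ^+ 2 * y ^+ 2
     - 24 * x * y ^+ 3 - 131 * x ^+ 3 - 684 * x ^+ 2 * y - 393 * x * y ^+ 2
     - 34 * y ^+ 3 - 639 * x ^+ 2 - 1535 * x * y - 396 * y ^+ 2 - 1380 * x
     - 1286 * y - 1116) * E (m + 3) n
  + (x + 3) * (2 * x * y + 2 * x + 5 * y + 7) * (x + y + 4) * (x + y + 3)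
    * E (m + 4) n
  = 0.
Proof.
move=> x y; rewrite !(addn1, addn2, addn3, addn4).
have R0 := @E_second_order m n hm hn.
have R1 := @E_second_order m.+1 n isT hn.
have R2 := @E_second_order m.+2 n isT hn.
(* All three binomials become rational multiples of ['C(m + n, m)], so only identities between
   rational functions remain. *)
rewrite !binS_ratio !addSn -!natr1 natrD -/x -/y in R0 R1 R2.
have B0 : 'C(m + n, m)%:R != 0 :> rat by rewrite pnatr_eq0 -lt0n bin_gt0 leq_addr.
have x0 : 0 <= x := ler0n _ _; have y0 : 0 <= y := ler0n _ _.
move: x y 'C(_, _)%:R (E m n) (E m.+1 n) (E m.+2 n) (E m.+3 n) (E m.+4 n)
  x0 y0 B0 R0 R1 R2.
move=> {hm hn} x y B e0 e1 e2 e3 e4 x0 y0 B0 R0 R1 R2.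
(* [a0], [a1] and [a2] are forced by the coefficients of [E m n], [E (m + 1) n]
   and [E (m + 4) n]. *)
pose a0 : rat := (x + 1) * (x + 2) * (x + 3) * (2 * x * y + 2 * x + 7 * y + 9).
pose a1 : rat := - ((x + 2) * (x + 3) * (4 * x ^+ 2 * y + 4 * x ^+ 2
  + 2 * x * y ^+ 2 + 28 * x * y + 30 * x + 7 * y ^+ 2 + 50 * y + 55)).
pose a2 : rat := (x + 3) * (x + 4) * (2 * x * y + 2 * x + 5 * y + 7) * (x + y + 4).
have := congr2 +%R (congr2 +%R (congr1 ( *%R a0) R0) (congr1 ( *%R a1) R1))
  (congr1 ( *%R a2) R2).
(* [r] collects the inhomogeneous terms; both the part in [1 / B] and the rational part vanish. *)
set r := (X in _ = X -> _); have -> : r = 0.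
  rewrite /r /a0 /a1 /a2; field.
  by rewrite B0 /=; repeat (apply/andP; split); apply: lt0r_neq0; lra.
move=> <-; rewrite /a0 /a1 /a2; field.
by repeat (apply/andP; split); apply: lt0r_neq0; lra.
Qed.
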